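(* Let $n$ be sufficiently large and let $G$ be a graph with $n$ vertices and edge density $p\ge n^{-1/8}$. If $24p^{-1/2}\le r\le\frac12\sqrt{p^{-1}\log n}$ and $t\le\frac{1}{32}e^{pr^2/256}\log n$, then $G$ contains a $K_t$-minor in which each of the connected vertex sets corresponding to the vertices of $K_t$ has at most $8r$ vertices.
   Context: Logarithms are base 2. The edge density of an $n$-vertex graph with $e$ edges is $e/\binom n2$. A $K_t$-minor in $G$ consists of $t$ pairwise disjoint vertex sets $A_1,\dots,A_t$, each inducing a connected subgraph of $G$, such that for every $i\ne j$ there is an edge of $G$ between $A_i$ and $A_j$; the $A_i$ are the connected sets corresponding to the vertices of $K_t$. *)

(* Defs.v *)
From HB Require Import structures.
From mathcomp Require Import all_boot all_order all_algebra.
From mathcomp Require Import all_classical all_reals all_analysis.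

Set Implicit Arguments.
Unset Strict Implicit.
Unset Printing Implicit Defensive.

Import Order.TTheory GRing.Theory Num.Theory.
Local Open Scope ring_scope.

Record sgraph (V : finType) := SGraph {
  adj :> rel V;
  adj_sym : symmetric adj;
  adj_irrefl : irreflexive adj }.

Section Graph.
Variables (V : finType) (G : sgraph V).

Definition edges : {set {set V}} :=
  [set E : {set V} | [exists x, exists y, G x y && (E == [set x; y])]].

Definition edge_density (R : realType) : R :=
  #|edges|%:R / 'C(#|V|, 2)%:R.

Definition induced (A : {set V}) : rel V :=
  [rel x y | [&& x \in A, y \in A & G x y]].

(* The empty set does not count as connected. *)
Definition connected_set (A : {set V}) : Prop :=
  A != finset.set0 /\ {in A &, forall x y, connect (induced A) x y}.

Definition Kminor (t : nat) (A : 'I_t -> {set V}) : Prop :=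
  [/\ forall i, connected_set (A i),
      forall i j, i != j -> [disjoint A i & A j] &
      forall i j, i != j -> exists x y, [/\ x \in A i, y \in A j & G x y]].

End Graph.

Definition log2 (R : realType) (x : R) : R := ln x / ln 2.

(* Main.v *)
(* The minor is found greedily, each choice being justified by averaging.
   Dependent random choice gives a large set [X], any two vertices of which have
   many common neighbours, and a large set [Y], each vertex of which is adjacent
   to a positive proportion (of order p) of [X].  Greedily pick many disjoint
   sets [B] of at most r vertices of [X], each with all but a fraction
   e^(-pr/64) of [Y] in its neighbourhood.  Then greedily pick disjoint sets
   [C_1], ..., [C_t] of at most r vertices of [Y]: each [C_j] can be made to touch
   all but a fraction e^(-pr^2/256) of the sets [B] that touch the previous ones.
   This loses only a small power of n altogether, so t of the sets [B] touch every
   [C_j]; this is where the factor log n in the bound on t comes from.  Finally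
   [B_i] and [C_i] are joined by linking each of their vertices to a fixed vertex
   of [B_i] through at most two new vertices. *)
Require Import Defs.
From HB Require Import structures.
From mathcomp Require Import all_boot all_order all_algebra.
From mathcomp Require Import all_classical all_reals all_analysis.
From mathcomp Require Import fintype finset.
From mathcomp Require Import ring lra.

Set Implicit Arguments.
Unset Strict Implicit.
Unset Printing Implicit Defensive.

Import Order.TTheory GRing.Theory Num.Theory.
Local Open Scope ring_scope.

(** * Double counting, averaging and greedy covering *)

Lemma sum_card_rel (T1 T2 : finType) (A : {set T1}) (B : {set T2})
    (e : T1 -> T2 -> bool) :
  (\sum_(x in A) #|[set y in B | e x y]| =
   \sum_(y in B) #|[set x in A | e x y]|)%N.
Proof.
have E (T : finType) (D : {set T}) (P : pred T) :
    (#|[set z in D | P z]| = \sum_(z in D) P z)%N.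
  rewrite -sum1_card big_mkcond /= [RHS]big_mkcond /=; apply: eq_bigr => z _.
  by rewrite inE; case: (z \in D); case: (P z).
under eq_bigr do rewrite E.
by rewrite exchange_big; apply: eq_bigr => y _; rewrite E.
Qed.

Lemma exists_ge_mean (R : realDomainType) (T : finType) (S : {set T})
    (f : T -> R) (b : R) :
  S != set0 -> b * #|S|%:R <= \sum_(i in S) f i ->
  exists2 i, i \in S & b <= f i.
Proof.
move=> /set0Pn [i0 i0S] le_sum.
case: (boolP [exists i in S, b <= f i]) => [/existsP [i /andP[]]|]; first by exists i.
rewrite negb_exists => /forallP lt_b; move: le_sum.
rewrite leNgt mulr_natr -sumr_const => /negP []; apply: ltr_sum.
  by apply/hasP; exists i0; rewrite ?mem_index_enum.
by move=> i iS; move: (lt_b i); rewrite iS /= -ltNge.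
Qed.

(** By averaging, some element of [S] is related to at least a fraction [q] of whatever part of [W]
    is still missed. Each of [k] rounds therefore shrinks the missed part by a factor [1 - q];
    repeated picks do no harm. *)
Lemma greedy_cover (R : realFieldType) (T1 T2 : finType) (e : T1 -> T2 -> bool)
    (S : {set T1}) (W : {set T2}) (q : R) (k : nat) :
  S != set0 -> q <= 1 ->
  {in W, forall w, q * #|S|%:R <= #|[set s in S | e s w]|%:R} ->
  exists D : {set T1}, [/\ D \subset S, (#|D| <= k)%N &
    #|[set w in W | [forall s in D, ~~ e s w]]|%:R <= (1 - q) ^+ k * #|W|%:R].
Proof.
move=> S0 q1 degW; elim: k => [|k [D [DS Dk leD]]].
  exists set0; split; rewrite ?sub0set ?cards0 // expr0 mul1r ler_nat.
  by apply/subset_leq_card/subsetP => w; rewrite inE => /andP[].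
pose W' := [set w in W | [forall s in D, ~~ e s w]].
have [s sS les] : exists2 s, s \in S &
    q * #|W'|%:R <= #|[set w in W' | e s w]|%:R.
  apply: exists_ge_mean => //.
  rewrite -natr_sum sum_card_rel natr_sum mulrAC mulr_natr -sumr_const.
  by apply: ler_sum => w; rewrite inE => /andP[wW _]; apply: degW.
exists (s |: D); split.
- by rewrite subUset sub1set sS.
- by rewrite cardsU1; case: (s \notin D); rewrite ?add1n ?add0n ?ltnS // ltnW.
have -> : [set w in W | [forall s0 in s |: D, ~~ e s0 w]] =
    W' :\: [set w in W' | e s w].
  apply/setP => w; rewrite !inE; case: (w \in W) => //=.
  apply/forallP/andP => [h|[h1 h2] z].
    have hD : [forall s0 in D, ~~ e s0 w].
      by apply/forallP => z; apply/implyP => zD; move: (h z); rewrite !inE zD orbT.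
    by rewrite hD; move: (h s); rewrite !inE eqxx /=.
  rewrite !inE; apply/implyP => /orP[/eqP ->|zD]; first by move: h1; rewrite h2.
  by move/forallP: h2 => /(_ z); rewrite zD.
have sub : [set w in W' | e s w] \subset W'.
  by apply/subsetP => w; rewrite inE => /andP[].
rewrite cardsD (setIidPr sub) natrB ?subset_leq_card //.
rewrite exprS -mulrA; apply: le_trans (ler_wpM2l _ leD); last by rewrite subr_ge0.
by rewrite mulrBl mul1r lerD2l lerN2.
Qed.

(** * Dependent random choice *)

Section DependentRandomChoice.
Variables (V : finType) (G : sgraph V).

(** The factor 2 of the handshake identity is given up: ordered adjacent pairs map onto the
    edges. *)
Lemma card_edges_le_sum_deg :
  (#|edges G| <= \sum_x #|[set y | G x y]|)%N.
Proof.
pose P := [set z : V * V | G z.1 z.2].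
have -> : (\sum_x #|[set y | G x y]| = #|P|)%N.
  transitivity (\sum_(x : V) \sum_(y : V) (if G x y then 1 else 0))%N.
    by apply: eq_bigr => x _; rewrite -sum1dep_card big_mkcond.
  by rewrite pair_bigA -sum1dep_card [RHS]big_mkcond.
have sub : edges G \subset [set [set z.1; z.2] | z in P].
  apply/subsetP => E; rewrite inE => /existsP[x /existsP[y /andP[Gxy /eqP ->]]].
  by apply/imsetP; exists (x, y); rewrite ?inE.
by apply: leq_trans (subset_leq_card sub) _; apply: leq_imset_card.
Qed.

(* [X] is the common neighbourhood of a suitable pair of vertices, minus one
   vertex from each pair with few common neighbours. *)
Lemma dependent_random_choice (R : realFieldType) (c : R) (m : nat) :
  (0 < #|V|)%N -> 0 <= c ->
  c * #|V|%:R ^+ 2 <= (\sum_x #|[set y | G x y]|)%:R ->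
  m%:R ^+ 2 <= c ^+ 2 * #|V|%:R / 8 ->
  exists X Y : {set V},
  [/\ c ^+ 2 * #|V|%:R / 8 <= #|X|%:R,
      {in X &, forall x x', x != x' -> (m < #|[set w | G w x && G w x']|)%N},
      {in Y, forall y, c / 4 * #|X|%:R <= #|[set x in X | G x y]|%:R} &
      (0 < #|X|)%N -> c / 4 * #|V|%:R <= #|Y|%:R :> R].
Proof.
move=> V0 c0 degG mc.
set n : R := #|V|%:R in degG mc *.
have n0 : 0 < n by rewrite ltr0n.
pose d x : R := #|[set y | G x y]|%:R.
rewrite natr_sum in degG.
(* The average degree is at least [c * n]. Keeping only vertices of at least half that degree costs
   little in the degree sum, and it is what makes [Y] large at the end. *)
pose H := [set x | c / 2 * n <= d x].
have degH : c / 2 * n ^+ 2 <= \sum_(x in H) d x.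
  have -> : \sum_(x in H) d x = \sum_x d x - \sum_(x in ~: H) d x.
    rewrite [\sum_x d x](bigID (mem H)) /= -addrA [X in _ = _ + X](_ : _ = 0) ?addr0 //.
    by apply/eqP; rewrite subr_eq0; apply/eqP/eq_bigl => x; rewrite !inE.
  have : \sum_(x in ~: H) d x <= \sum_(x in ~: H) (c / 2 * n).
    by apply: ler_sum => x; rewrite !inE -ltNge => /ltW.
  rewrite sumr_const -mulr_natr.
  have : c / 2 * n * #|~: H|%:R <= c / 2 * n * n.
    by rewrite ler_wpM2l ?mulr_ge0 ?ler_nat ?max_card //; lra.
  by rewrite -/d in degG; nra.
have degH2 : c ^+ 2 * n ^+ 3 / 4 <= \sum_(x in H) d x ^+ 2.
  apply: (@le_trans _ _ (\sum_(x in H) (c / 2 * n) * d x)).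
    rewrite -mulr_sumr; apply: le_trans (ler_wpM2l _ degH); last by rewrite mulr_ge0 //; lra.
    by nra.
  apply: ler_sum => x; rewrite inE => hx.
  by rewrite expr2 ler_wpM2r.
pose Bd := [set z : V * V | (z.1 != z.2) && (#|[set w | G w z.1 && G w z.2]| <= m)%N].
pose XT (T : V * V) := [set x in H | G T.1 x && G T.2 x].
pose BT (T : V * V) := [set z in Bd | [&& G T.1 z.1, G T.1 z.2, G T.2 z.1 & G T.2 z.2]].
(* A vertex [x] is adjacent to both entries of exactly [d x ^+ 2] ordered pairs [T]. *)
have sumX : \sum_(T in [set: V * V]) #|XT T|%:R = \sum_(x in H) d x ^+ 2.
  rewrite -natr_sum sum_card_rel natr_sum; apply: eq_bigr => x _.
  rewrite /d expr2 -natrM -cardsX; congr (_%:R); apply: eq_card => T.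
  by rewrite !inE -!(adj_sym G x).
(* A bad pair is counted for [T] only if both entries of [T] are among its at most [m] common
   neighbours. *)
have sumB : \sum_(T in [set: V * V]) #|BT T|%:R <= n ^+ 2 * m%:R ^+ 2.
  rewrite -natr_sum sum_card_rel natr_sum.
  apply: (@le_trans _ _ (\sum_(z in Bd) (m%:R ^+ 2))).
    apply: ler_sum => z; rewrite inE => /andP[_ zm].
    rewrite expr2 -natrM ler_nat; apply: leq_trans (leq_mul zm zm).
    rewrite -cardsX; apply: subset_leq_card; apply/subsetP => T.
    by rewrite !inE /= => /and4P[-> -> -> ->].
  rewrite sumr_const -(mulr_natl (_ ^+ 2)) ler_wpM2r ?exprn_ge0 //.
  rewrite -natrX ler_nat; apply: leq_trans (max_card _) _.
  by rewrite card_prod expnS expn1.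
(* Over the [n ^+ 2] pairs [T], the mean of [#|XT T|] is at least [c ^+ 2 * n / 4], and that of
   [#|BT T|] is at most [m ^ 2], hence at most half of this. *)
have [T _ hT] : exists2 T, T \in [set: V * V] &
    c ^+ 2 * n / 8 <= #|XT T|%:R - #|BT T|%:R.
  apply: exists_ge_mean.
    by apply/set0Pn; case/card_gt0P: V0 => v _; exists (v, v).
  rewrite sumrB sumX cardsT card_prod natrM -/n.
  have : n ^+ 2 * m%:R ^+ 2 <= n ^+ 2 * (c ^+ 2 * n / 8) by rewrite ler_wpM2l ?exprn_ge0 // ltW.
  move: degH2 sumB; move: (\sum_(x in H) _) (\sum_(i in _) _) => a b; clear; lra.
pose X := XT T :\: [set z.1 | z in BT T].
have XH x : x \in X -> c / 2 * n <= d x by rewrite !inE => /andP[_ /andP[]].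
exists X, [set y | c / 4 * #|X|%:R <= #|[set x in X | G x y]|%:R]; split.
- apply: le_trans hT _; rewrite lerBlDr -natrD ler_nat addnC -leq_subLR.
  rewrite cardsD leq_sub2l //.
  apply: leq_trans (leq_imset_card (fun z : V * V => z.1) (BT T)).
  by apply: subset_leq_card; apply: subsetIr.
- move=> x x' xX x'X xx'; rewrite ltnNge; apply/negP => lem.
  move: xX x'X; rewrite 2!inE => /andP[/negP xB xT]; rewrite 2!inE => /andP[_ x'T].
  apply: xB; apply/imsetP; exists (x, x') => //.
  move: xT x'T; rewrite !inE /= xx' lem => /andP[_ /andP[-> ->]].
  by move=> /andP[_ /andP[-> ->]].
- by move=> y; rewrite inE.
move=> X0; set Y := [set y | _].
have sumXd : #|X|%:R * (c / 2 * n) <= \sum_y #|[set x in X | G x y]|%:R.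
  have -> : \sum_y #|[set x in X | G x y]|%:R = \sum_(x in X) d x.
    transitivity (\sum_(y in [set: V]) #|[set x in X | G x y]|%:R : R).
      by apply: eq_bigl => y; rewrite inE.
    rewrite -natr_sum -sum_card_rel natr_sum; apply: eq_bigr => x _.
    by congr (_%:R); apply: eq_card => y; rewrite !inE.
  by rewrite mulrC mulr_natr -sumr_const; apply: ler_sum => x /XH.
(* A vertex outside [Y] contributes less than [c / 4 * #|X|], so half of the lower bound [sumXd]
   must come from [Y]. *)
have : \sum_y #|[set x in X | G x y]|%:R <=
    \sum_y (c / 4 * #|X|%:R + (if y \in Y then #|X|%:R else 0)).
  apply: ler_sum => y _; case: ifPn => [_|]; last by rewrite inE -ltNge addr0 => /ltW.
  rewrite -[leLHS]add0r lerD ?mulr_ge0 ?divr_ge0 // ler_nat.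
  by apply: subset_leq_card; apply/subsetP => x; rewrite inE => /andP[].
rewrite big_split /= -big_mkcond /= !sumr_const cardT -cardE -!(mulr_natr (_ * _)) -/n -mulr_natr.
move=> /(le_trans sumXd) h.
by rewrite -(ler_pM2l (_ : 0 < #|X|%:R)) ?ltr0n //; nra.
Qed.

End DependentRandomChoice.

(** * The families of sets [B] and [C] *)

Section Families.
Variables (R : realFieldType) (V : finType) (G : sgraph V).

Lemma exists_covering_family (X Y : {set V}) (q : R) (k N : nat) :
  Y != set0 -> 0 < q <= 1 -> (0 < k)%N -> (N * k)%:R <= q * #|X|%:R ->
  {in Y, forall y, 2 * q * #|X|%:R <= #|[set x in X | G x y]|%:R} ->
  exists F : {set {set V}}, [/\ #|F| = N,
    {in F, forall B : {set V}, [/\ B \subset X, B != set0, (#|B| <= k)%N &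
      #|[set y in Y | [forall x in B, ~~ G x y]]|%:R <= (1 - q) ^+ k * #|Y|%:R]} &
    {in F &, forall B B' : {set V}, B != B' -> [disjoint B & B']}].
Proof.
move=> Y0 /andP[q0 q1] k0 + degY; elim: N => [|N IHN] leN.
  by exists set0; split; rewrite ?cards0 // => B; rewrite inE.
have [|F [cF propF disjF]] := IHN.
  by apply: le_trans leN; rewrite ler_nat leq_mul.
have cU : (#|cover F| <= N * k)%N.
  apply: leq_trans (leq_card_cover _) _; rewrite -cF -sum_nat_const.
  by apply: leq_sum => B /propF[].
pose S := X :\: cover F.
have degS : {in Y, forall y, q * #|S|%:R <= #|[set x in S | G x y]|%:R /\ (0 < #|S|)%N}.
  move=> y /degY le_deg.
  have h1 : (#|[set x in X | G x y]| <= #|[set x in S | G x y]| + #|cover F|)%N.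
    rewrite addnC -leq_subLR.
    apply: leq_trans (_ : #|[set x in X | G x y] :\: cover F| <= _)%N.
      by rewrite cardsD leq_sub2l // subset_leq_card // subsetIr.
    by apply/subset_leq_card/subsetP => x; rewrite !inE => /and3P[-> -> ->].
  have h2 : (#|S| <= #|X|)%N by apply/subset_leq_card/subsetDl.
  have h3 : (#|[set x in S | G x y]| <= #|S|)%N.
    by apply/subset_leq_card/subsetP => x; rewrite inE => /andP[].
  move: h1 cU leN le_deg; rewrite mulSn -!(ler_nat R) !natrD.
  have : q * #|S|%:R <= q * #|X|%:R by rewrite ler_pM2l ?ler_nat.
  move=> g1 g2 g3 g4 g5; have k0' : 0 < k%:R :> R by rewrite ltr0n.
  split; first by lra.
  rewrite ler_nat; apply: leq_trans h3; rewrite -(ltr0n R).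
  by have := ler0n R (N * k); lra.
have S0 : S != set0 by case/set0Pn: Y0 => y /degS[_]; rewrite card_gt0.
have [B [BS Bk covB]] : exists B : {set V}, [/\ B \subset S, (#|B| <= k)%N &
    #|[set y in Y | [forall x in B, ~~ G x y]]|%:R <= (1 - q) ^+ k * #|Y|%:R].
  by apply: greedy_cover => // y /degS[].
(* The empty set would miss all of [Y]. Nonemptiness also makes [B] different from the earlier sets,
   from which it is disjoint. *)
have B0 : B != set0.
  apply: contraTneq covB => ->; rewrite -ltNge.
  rewrite [X in _ < X%:R](_ : _ = #|Y|); last first.
    apply: eq_card => y; rewrite !inE; case: (y \in Y) => //=.
    by apply/forallP => x; rewrite inE.
  rewrite -[ltRHS]mul1r ltr_pM2r ?ltr0n ?card_gt0 //.
  by rewrite exprn_ilt1 ?subr_ge0 // ?ltrBlDr ?ltrDl // -lt0n.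
have disjB : {in F, forall B' : {set V}, [disjoint B & B']}.
  move=> B' B'F; rewrite disjoint_subset; apply/subsetP => x xB.
  move/subsetP: BS => /(_ _ xB); rewrite !inE => /andP[xF _].
  by apply: contra xF => xB'; apply/bigcupP; exists B'.
have BF : B \notin F.
  apply: contraNN B0 => BF; move: (disjB _ BF).
  by rewrite -setI_eq0 setIid.
exists (B |: F); split.
- by rewrite cardsU1 BF cF.
- move=> B'; rewrite !inE => /orP[/eqP ->|/propF //]; split => //.
  by apply: subset_trans BS (subsetDl _ _).
move=> B1 B2; rewrite !inE => /orP[/eqP ->|B1F] /orP[/eqP ->|B2F].
- by rewrite eqxx.
- by move=> _; apply: disjB.
- by move=> _; rewrite disjoint_sym; apply: disjB.
- exact: disjF.
Qed.

Lemma exists_hitting_sets (F : {set {set V}}) (Y U : {set V}) (eta : R) (k t : nat) :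
  0 <= eta <= 1 ->
  (forall S : {set V}, S \subset Y -> (#|Y| <= #|S| + (#|U| + t * k))%N ->
    S != set0 /\ {in F, forall B : {set V},
      (1 - eta) * #|S|%:R <= #|[set y in S | [exists x in B, G x y]]|%:R}) ->
  exists (C : nat -> {set V}) (F' : {set {set V}}),
  [/\ F' \subset F, (1 - eta ^+ k) ^+ t * #|F|%:R <= #|F'|%:R,
      forall i, (i < t)%N -> C i \subset Y :\: U /\ (#|C i| <= k)%N,
      forall i j, (i < j < t)%N -> [disjoint C i & C j] &
      forall (B : {set V}) i, B \in F' -> (i < t)%N ->
        exists x y, [/\ x \in B, y \in C i & G x y]].
Proof.
move=> /andP[e0 e1] hS.
suff main j : (j <= t)%N -> exists (C : nat -> {set V}) (F' : {set {set V}}),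
  [/\ F' \subset F, (1 - eta ^+ k) ^+ j * #|F|%:R <= #|F'|%:R,
      forall i, (i < j)%N -> C i \subset Y :\: U /\ (#|C i| <= k)%N,
      forall i l, (i < l < j)%N -> [disjoint C i & C l] &
      forall (B : {set V}) i, B \in F' -> (i < j)%N ->
        exists x y, [/\ x \in B, y \in C i & G x y]] by exact: main.
elim: j => [_|j IHj jt].
  exists (fun=> set0), F; split=> //; first by rewrite expr0 mul1r.
  by move=> i l; rewrite ltn0 andbF.
have [C [F' [F'F cF' propC disjC adjC]]] := IHj (ltnW jt).
pose W := \bigcup_(i < j) C i.
have cW : (#|W| <= t * k)%N.
  apply: leq_trans (_ : j * k <= _)%N; last by rewrite leq_mul // ltnW.
  rewrite -[X in (_ <= X * _)%N](card_ord j) -sum_nat_const.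
  apply: leq_trans (_ : \sum_(i < j) #|C i| <= _)%N; last first.
    by apply: leq_sum => i _; case: (propC i).
  rewrite /W; elim/big_rec2: _ => [|i x y _ le_xy]; first by rewrite cards0.
  by apply: leq_trans (leq_card_setU _ _) _; rewrite leq_add2l.
pose S := Y :\: (U :|: W).
have SY : S \subset Y by apply: subsetDl.
have [|S0 degS] := hS S SY.
  apply: leq_trans (_ : #|S| + #|U :|: W| <= _)%N.
    rewrite addnC -leq_subLR cardsD leq_sub2l //.
    by apply/subset_leq_card/subsetIr.
  by rewrite leq_add2l; apply: leq_trans (leq_card_setU _ _) _; rewrite leq_add2l.
have [D [DS Dk covD]] : exists D : {set V}, [/\ D \subset S, (#|D| <= k)%N &
   #|[set B in F' | [forall y in D, ~~ [exists x in B, G x y]]]|%:R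
     <= (1 - (1 - eta)) ^+ k * #|F'|%:R].
  apply: (@greedy_cover R _ _ (fun y (B : {set V}) => [exists x in B, G x y])) => //.
    by rewrite gerBl.
  by move=> B /(subsetP F'F) /degS.
rewrite subKr in covD.
pose bad := [set B in F' | [forall y in D, ~~ [exists x in B, G x y]]].
exists (fun i => if i == j then D else C i), (F' :\: bad); split.
- by apply: subset_trans (subsetDl _ _) F'F.
- rewrite exprS -mulrA; apply: le_trans (ler_wpM2l _ cF') _.
    by rewrite subr_ge0 exprn_ile1.
  have sub : bad \subset F' by apply/subsetP => B; rewrite inE => /andP[].
  by rewrite cardsD (setIidPr sub) natrB ?subset_leq_card // mulrBl mul1r lerD2l lerN2.
- move=> i; rewrite ltnS leq_eqVlt; case: eqVneq => [_ _|_ /= /propC //].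
  by split=> //; apply: subset_trans DS _; rewrite setDS // subsetUl.
- move=> i l /andP[il]; rewrite ltnS leq_eqVlt => lj.
  have ij : (i < j)%N by case/orP: lj => [/eqP <- //|]; apply: ltn_trans.
  rewrite (ltn_eqF ij); move: lj; case: eqVneq => [_ _|_ /= lj]; last by apply: disjC; rewrite il.
  rewrite disjoint_sym disjoint_subset; apply/subsetP => x /(subsetP DS).
  rewrite !inE => /andP[h _]; apply: contra h => xC; apply/orP; right.
  by apply/bigcupP; exists (Ordinal ij).
move=> B i; rewrite inE => /andP[Bbad BF']; rewrite ltnS leq_eqVlt.
case: eqVneq => [_ _|_ /= ij]; last exact: adjC.
move: Bbad; rewrite inE BF' /= negb_forall => /existsP[y].
rewrite negb_imply negbK => /andP[yD /existsP[x /andP[xB Gxy]]].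
by exists x, y.
Qed.

End Families.

(** * Connecting sets through new vertices *)

Section Linking.
Variables (V : finType) (G : sgraph V).

Lemma induced_sym (A : {set V}) : symmetric (Defs.induced G A).
Proof. by move=> x y; rewrite /Defs.induced /= adj_sym andbCA. Qed.

Lemma connected_set_center (A : {set V}) b :
  b \in A -> {in A, forall x, connect (Defs.induced G A) b x} -> connected_set G A.
Proof.
move=> bA conn; split; first by apply/set0Pn; exists b.
move=> x y xA yA; apply: connect_trans (conn _ yA).
by rewrite sym_connect_sym ?conn //; apply: induced_sym.
Qed.

Lemma sub_connect_induced (A B : {set V}) :
  A \subset B -> subrel (connect (Defs.induced G A)) (connect (Defs.induced G B)).
Proof.
move=> AB; apply: connect_sub => x y /and3P[xA yA Gxy]; apply: connect1.
by apply/and3P; split=> //; apply: (subsetP AB).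
Qed.

Lemma connected_set1 b : connected_set G [set b].
Proof.
by apply: (@connected_set_center _ b) => [|x]; rewrite inE // => /eqP ->; apply: connect0.
Qed.

Lemma connected_setU1 (A : {set V}) a z :
  connected_set G A -> a \in A -> G a z -> connected_set G (z |: A).
Proof.
move=> [_ conn] aA Gaz; have sub : A \subset z |: A by apply: subsetUr.
apply: (@connected_set_center _ a); first by rewrite inE aA orbT.
move=> x; rewrite !inE => /orP[/eqP ->|xA].
  by apply: connect1; rewrite /Defs.induced /= !inE aA eqxx Gaz orbT.
by apply: sub_connect_induced sub _ _ _; apply: conn.
Qed.

Lemma connected_set_bigcup (I : finType) (P : {set I}) (F : I -> {set V}) b :
  P != set0 -> {in P, forall i, connected_set G (F i) /\ b \in F i} ->
  connected_set G (\bigcup_(i in P) F i).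
Proof.
case/set0Pn=> i0 i0P connF; apply: (@connected_set_center _ b).
  by apply/bigcupP; exists i0 => //; case: (connF _ i0P).
move=> x /bigcupP[i iP xF]; have [[_ conn] bF] := connF _ iP.
by apply: sub_connect_induced (bigcup_sup i iP) _ _ _; apply: conn.
Qed.

Lemma exists_notin (A U : {set V}) : (#|U| < #|A|)%N -> exists2 x, x \in A & x \notin U.
Proof.
by move=> lt; have /subsetPn : ~~ (A \subset U); first
  by apply: contraL lt => /subset_leq_card; rewrite -leqNgt.
Qed.

Variables (X Y : {set V}) (m : nat).
Hypothesis codegX : {in X &, forall x x', x != x' ->
  (m < #|[set w | G w x && G w x']|)%N}.
Hypothesis degY : {in Y, forall y, (m < #|[set x in X | G x y]|)%N}.

(** More than [m] candidates cannot all lie in [U]. A vertex of [X] thus reaches [b] through one new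
    common neighbour, and a vertex of [Y] first steps to a new vertex of [X]. *)
Lemma exists_link (U : {set V}) b z :
  (#|U| <= m)%N -> b \in X -> b \in U -> z \in X :|: Y ->
  exists E : {set V}, [/\ (#|E| <= 2)%N, [disjoint E & U] &
    connected_set G (E :|: [set z; b])].
Proof.
move=> Um bX bU zXY.
have linkX x : x \in X -> x != b ->
    exists2 w, w \notin U & connected_set G [set x; w; b].
  move=> xX xb; have [w] := exists_notin (leq_ltn_trans Um (codegX xX bX xb)).
  rewrite inE => /andP[Gwx Gwb] wU; exists w => //.
  rewrite -setUA; apply: (@connected_setU1 _ w) => //; last by rewrite !inE eqxx.
  apply: (@connected_setU1 _ b); rewrite ?inE //; last by rewrite adj_sym.
  exact: connected_set1.
have [-> {zXY z}|zb] := eqVneq z b.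
  exists set0; rewrite cards0 -setI_eq0 set0I eqxx set0U setUid.
  by split=> //; apply: connected_set1.
case/setUP: zXY => [zX|zY].
  have [w wU conn] := linkX _ zX zb.
  exists [set w]; rewrite cards1 disjoints1; split=> //.
  by rewrite setUCA setUA.
have [x] := exists_notin (leq_ltn_trans Um (degY zY)).
rewrite inE => /andP[xX Gxz] xU.
(* Since [b] lies in [U] and [x] does not, they differ. *)
have [|w wU conn] := linkX _ xX; first by apply: contraNneq xU => ->.
exists [set x; w]; split.
- by rewrite cards2; case: (_ != _).
- rewrite disjoint_subset; apply/subsetP => v.
  by rewrite !inE => /orP[] /eqP ->.
rewrite setUCA; apply: (@connected_setU1 _ x) => //.
by rewrite !inE eqxx.
Qed.

(** All links avoid the same [U] but may overlap one another: they end up in one set, held together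
    by [b]. Two new vertices per element of [D] give the factor 3. *)
Lemma exists_connected_hull (U D : {set V}) b :
  (#|U| <= m)%N -> D \subset U -> D \subset X :|: Y -> b \in D -> b \in X ->
  exists A : {set V}, [/\ D \subset A, connected_set G A,
    (#|A| <= 3 * #|D|)%N & A :&: U \subset D].
Proof.
move=> Um DU DXY bD bX.
have [E propE] : exists E : V -> {set V}, forall z, z \in D ->
    [/\ (#|E z| <= 2)%N, [disjoint E z & U] & connected_set G (E z :|: [set z; b])].
  apply: (fin_all_exists (P := fun z (Ez : {set V}) => z \in D ->
    [/\ (#|Ez| <= 2)%N, [disjoint Ez & U] & connected_set G (Ez :|: [set z; b])])) => z.
  case: (boolP (z \in D)) => [zD|_]; last by exists set0.
  have [E ?] := exists_link Um bX (subsetP DU _ bD) (subsetP DXY _ zD).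
  by exists E.
pose A := \bigcup_(z in D) (E z :|: [set z; b]).
have AE : A = (\bigcup_(z in D) E z) :|: D.
  apply/setP => x; rewrite inE; apply/bigcupP/orP => [[z zD]|].
    rewrite !inE => /or3P[xE|/eqP ->|/eqP ->]; [|by right|by right].
    by left; apply/bigcupP; exists z.
  case=> [/bigcupP[z zD xE]|xD]; first by exists z; rewrite // inE xE.
  by exists x; rewrite // !inE eqxx orbT.
exists A; split.
- by rewrite AE subsetUr.
- apply: (@connected_set_bigcup _ _ _ b); first by apply/set0Pn; exists b.
  by move=> z /propE[_ _ conn]; split=> //; rewrite !inE eqxx !orbT.
- rewrite AE; apply: leq_trans (leq_card_setU _ _) _.
  rewrite mulSnr leq_add2r mulnC -sum_nat_const.
  apply: leq_trans (_ : \sum_(z in D) #|E z| <= _)%N; last first.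
    by apply: leq_sum => z /propE[].
  elim/big_rec2: _ => [|i x y _ le_xy]; first by rewrite cards0.
  by apply: leq_trans (leq_card_setU _ _) _; rewrite leq_add2l.
apply/subsetP => x; rewrite AE !inE => /andP[/orP[/bigcupP[z /propE[_ dis _] xE]|//] xU].
by move: (disjointFr dis xE); rewrite xU.
Qed.

(** The sets are enlarged one at a time. The forbidden set is the union of the finished hulls and
    the sets still waiting, so its size never exceeds [3 * d * t]. *)
Lemma exists_disjoint_connected_hulls (t d : nat) (D : 'I_t -> {set V}) (b : 'I_t -> V) :
  (3 * d * t <= m)%N ->
  (forall i, [/\ D i \subset X :|: Y, b i \in D i, b i \in X & (#|D i| <= d)%N]) ->
  (forall i j, i != j -> [disjoint D i & D j]) ->
  exists A : 'I_t -> {set V},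
  [/\ forall i, D i \subset A i, forall i, connected_set G (A i),
      forall i, (#|A i| <= 3 * d)%N & forall i j, i != j -> [disjoint A i & A j]].
Proof.
move=> dtm propD disjD.
suff main j : (j <= t)%N -> exists A : 'I_t -> {set V},
  [/\ forall i, D i \subset A i, forall i : 'I_t, (i < j)%N -> connected_set G (A i),
      forall i, (#|A i| <= 3 * d)%N & forall i l, i != l -> [disjoint A i & A l]].
  have [A [h1 h2 h3 h4]] := main t (leqnn t).
  by exists A; split=> // i; apply: h2.
elim: j => [_|j IHj jt].
  exists D; split=> // i; case: (propD i) => _ _ _ Dd.
  by apply: leq_trans Dd _; rewrite leq_pmull.
have [A [DA connA cA disjA]] := IHj (ltnW jt).
pose j' := Ordinal jt.
have [DXY bD bX Dd] := propD j'.
pose U := \bigcup_i A i.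
have Um : (#|U| <= m)%N.
  apply: leq_trans dtm; rewrite mulnC -[X in (_ <= X * _)%N](card_ord t) -sum_nat_const.
  apply: leq_trans (_ : \sum_(i < t) #|A i| <= _)%N; last by apply: leq_sum.
  rewrite /U; elim/big_rec2: _ => [|i x y _ le_xy]; first by rewrite cards0.
  by apply: leq_trans (leq_card_setU _ _) _; rewrite leq_add2l.
have DU : D j' \subset U by apply: subset_trans (DA j') (bigcup_sup j' _).
have [A' [DA' connA' cA' A'U]] := exists_connected_hull Um DU DXY bD bX.
have disjA' i : i != j' -> [disjoint A' & A i].
  move=> ij; rewrite disjoint_subset; apply/subsetP => x xA'; rewrite inE.
  apply/negP => xA; have xD : x \in D j'.
    by apply: (subsetP A'U); rewrite inE xA'; apply/bigcupP; exists i.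
  by move: (disjointFr (disjA _ _ ij) xA); rewrite (subsetP (DA j')).
exists (fun i => if i == j' then A' else A i); split.
- by move=> i; case: eqVneq => [->|].
- move=> i; case: eqVneq => // ij; rewrite ltnS leq_eqVlt => /orP[/eqP e|]; last exact: connA.
  by case/negP: ij; apply/eqP/val_inj.
- move=> i; case: ifP => // _; apply: leq_trans cA' _.
  by rewrite leq_mul2l Dd orbT.
move=> i l il.
have [ij|ij] := eqVneq i j'; have [lj|lj] := eqVneq l j'.
- by rewrite ij lj eqxx in il.
- exact: disjA'.
- by rewrite disjoint_sym; apply: disjA'.
- exact: disjA.
Qed.

End Linking.

(** * Assembling the minor under numerical conditions *)

(** Roles of the parameters: [c] is a relative average degree, [N] the number of sets [B], [k] the
    size bound for the sets [B] and [C], [u] the fraction of [Y] that may be used up, and [eta] the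
    fraction of the rest that a set [B] may miss. Each [B i :|: C i] has at most [2 * k] vertices
    and linking triples this. *)
Lemma exists_Kminor (R : realFieldType) (V : finType) (G : sgraph V)
    (c eta u : R) (k t N : nat) :
  (0 < k)%N -> 0 < c <= 1 -> 0 <= eta <= 1 -> 0 <= u < 1 ->
  c * #|V|%:R ^+ 2 <= (\sum_x #|[set y | G x y]|)%:R ->
  (6 * k * t)%:R ^+ 2 <= c ^+ 2 * #|V|%:R / 8 ->
  (6 * k * t)%:R < c / 4 * (c ^+ 2 * #|V|%:R / 8) ->
  (N * k)%:R <= c / 8 * (c ^+ 2 * #|V|%:R / 8) ->
  (N * k + t * k)%:R <= u * (c / 4 * #|V|%:R) ->
  (1 - c / 8) ^+ k <= eta * (1 - u) ->
  t%:R <= (1 - eta ^+ k) ^+ t * N%:R ->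
  exists A : 'I_t -> {set V}, Kminor G A /\ forall i, (#|A i| <= 6 * k)%N.
Proof.
move=> k0 /andP[c0 c1] /andP[e0 e1] /andP[u0 u1] degG m2 mX NX uY qeta tN.
have n0 : (0 < #|V|)%N.
  rewrite lt0n; apply: contraTneq mX => ->.
  by rewrite mulr0 mul0r mulr0 -leNgt ler0n.
have n0' : 0 < #|V|%:R :> R by rewrite ltr0n.
have [X [Y [cX codegX degY cYX]]] := dependent_random_choice n0 (ltW c0) degG m2.
have cY : c / 4 * #|V|%:R <= #|Y|%:R.
  by apply: cYX; rewrite -(ltr0n R); apply: lt_le_trans cX; rewrite !mulr_gt0 ?exprn_gt0 ?invr_gt0.
have Y0 : 0 < #|Y|%:R :> R by apply: lt_le_trans cY; rewrite !mulr_gt0 ?invr_gt0.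
have Yset0 : Y != set0 by rewrite -card_gt0 -(ltr0n R).
(* The degree fraction [c / 4] equals [2 * q] for [q = c / 8]. *)
have [||| F [cF propF disjF]] := @exists_covering_family R V G X Y (c / 8) k N Yset0 _ k0.
- by apply/andP; split; lra.
- apply: le_trans NX _; rewrite ler_wpM2l //; lra.
- move=> y /degY; apply: le_trans; rewrite ler_wpM2r //; lra.
pose U := cover F.
have cU : (#|U| <= N * k)%N.
  apply: leq_trans (leq_card_cover _) _; rewrite -cF -sum_nat_const.
  by apply: leq_sum => B /propF[].
have [||C [F' [F'F cF' propC disjC adjC]]] :=
    @exists_hitting_sets R V G F Y U eta k t _ _.
- by rewrite e0.
- move=> S SY cS.
  have leS : (1 - u) * #|Y|%:R <= #|S|%:R.
    have : (#|Y| <= #|S| + (N * k + t * k))%N.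
      by apply: leq_trans cS _; rewrite leq_add2l leq_add2r.
    rewrite -(ler_nat R) natrD => h.
    have : u * (c / 4 * #|V|%:R) <= u * #|Y|%:R by rewrite ler_wpM2l.
    by lra.
  split.
    by rewrite -card_gt0 -(ltr0n R); apply: lt_le_trans leS; rewrite mulr_gt0 // subr_gt0.
  move=> B BF; have [_ _ _ covB] := propF _ BF.
  have -> : [set y in S | [exists x in B, G x y]] =
      S :\: [set y in S | [forall x in B, ~~ G x y]].
    apply/setP => y; rewrite !inE; case: (y \in S); rewrite ?andbF ?andbT //=.
    rewrite -[LHS]negbK negb_exists; congr (~~ _).
    by apply: eq_forallb => x; rewrite negb_and implybE.
  rewrite cardsD (setIidPr _); last by apply/subsetP => y; rewrite inE => /andP[].
  rewrite natrB; last by apply/subset_leq_card/subsetP => y; rewrite inE => /andP[].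
  rewrite mulrBl mul1r lerD2l lerN2.
  (* What [B] misses in [Y] is at most [eta * (1 - u) * #|Y|], hence at most [eta * #|S|]. *)
  apply: (@le_trans _ _ #|[set y in Y | [forall x in B, ~~ G x y]]|%:R).
    rewrite ler_nat; apply/subset_leq_card/subsetP => y; rewrite !inE => /andP[yS ->].
    by rewrite (subsetP SY).
  apply: le_trans covB _; apply: le_trans (ler_wpM2l e0 leS).
  by rewrite mulrA ler_wpM2r.
have tF' : (t <= #|F'|)%N.
  by rewrite -(ler_nat R); apply: le_trans cF'; rewrite cF.
(* The default [set0] is never reached, as [F'] has at least [t] members. *)
pose B (i : 'I_t) := nth set0 (enum F') i.
have BF' i : B i \in F'.
  by rewrite -mem_enum mem_nth // -cardE (leq_trans (ltn_ord i)).
have BF i : B i \in F by apply: (subsetP F'F).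
have disjB i j : i != j -> [disjoint B i & B j].
  move=> ij; apply: disjF => //; rewrite nth_uniq ?enum_uniq // -cardE;
  exact: leq_trans (ltn_ord _) tF'.
have disjBC i (j : 'I_t) : [disjoint B i & C j].
  rewrite disjoint_sym disjoint_subset; apply/subsetP => x xC; rewrite inE.
  have [/subsetP/(_ _ xC) + _] := propC j (ltn_ord j).
  rewrite inE => /andP[xU _]; apply: contra xU => xB.
  by apply/bigcupP; exists (B i).
have disjCC (i j : 'I_t) : i != j -> [disjoint C i & C j].
  move=> ij; have : (i : nat) != j by [].
  rewrite neq_ltn => /orP[] h; last rewrite disjoint_sym;
  by apply: disjC; rewrite h /=; exact: ltn_ord.
have [b bB] : exists b : 'I_t -> V, forall i, b i \in B i.
  apply: (fin_all_exists (P := fun i x => x \in B i)) => i.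
  by have [_ /set0Pn[x xB] _ _] := propF _ (BF i); exists x.
have [||||A [DA connA cA disjA]] := @exists_disjoint_connected_hulls V G X Y (6 * k * t)
    codegX _ t (2 * k) (fun i => B i :|: C i) b _ _ _.
- move=> y yY; rewrite -(ltr_nat R); apply: lt_le_trans mX _.
  apply: le_trans (degY _ yY); rewrite ler_wpM2l //; lra.
- by rewrite mulnA.
- move=> i; have [BX _ Bk _] := propF _ (BF i); have [CY Ck] := propC i (ltn_ord i).
  split; first by rewrite setUSS //; apply: subset_trans CY (subsetDl _ _).
  + by rewrite inE bB.
  + exact: (subsetP BX).
  + by apply: leq_trans (leq_card_setU _ _) _; rewrite mul2n -addnn leq_add.
- move=> i j ij; rewrite disjoint_subset; apply/subsetP => x; rewrite !inE negb_or.
  case/orP=> xi; first by rewrite (disjointFr (disjB _ _ ij) xi) (disjointFr (disjBC i j) xi).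
  by rewrite (disjointFl (disjBC j i) xi) (disjointFr (disjCC _ _ ij) xi).
exists A; split; last by move=> i; have := cA i; rewrite mulnA.
(* Every surviving [B i] touches every [C j], which supplies the edge between the two hulls. *)
split=> // i j ij; have [x [y [xB yC Gxy]]] := adjC (B i) j (BF' i) (ltn_ord j).
exists x, y; split=> //; first by apply: (subsetP (DA i)); rewrite inE xB.
by apply: (subsetP (DA j)); rewrite inE yC orbT.
Qed.

(** * Estimates for exponentials, logarithms and degree sums *)

Section RealEstimates.
Variable R : realType.

Lemma expRN_le_inv (x : R) : 0 <= x -> expR (- x) <= (1 + x)^-1.
Proof.
move=> x0; rewrite expRN lef_pV2 ?posrE ?expR_gt0 ?expR_ge1Dx //.
by rewrite ltr_pwDl.
Qed.

Lemma ln2_ge_half : 1 / 2 <= ln 2 :> R.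
Proof.
rewrite -ler_expR lnK ?posrE //.
have : expR (- (1 / 2)) >= 1 - 1 / 2 :> R by exact: expR_ge1Dx.
rewrite expRN => h; rewrite -[leLHS]invrK -[leRHS]invrK lef_pV2 ?posrE ?invr_gt0 ?expR_gt0 //; lra.
Qed.

Lemma expR_le_onesub (x : R) : 0 <= x <= 1 / 2 -> expR (- (2 * x)) <= 1 - x.
Proof.
move=> /andP[x0 x1]; apply: le_trans (expRN_le_inv _) _; first by lra.
have y0 : 0 < 1 + 2 * x by lra.
by rewrite -(ler_pM2l y0) divff ?gt_eqF //; nra.
Qed.

(** Half of the exponent in [expR (- (q * k))] is kept; the other half pays for the factor
    [1 - u]. *)
Lemma onesubX_le_expR (q u : R) (k : nat) : 0 <= q <= 1 ->
  0 <= u <= 1 / 2 -> u <= q * k%:R / 4 ->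
  (1 - q) ^+ k <= expR (- (q * k%:R / 2)) * (1 - u).
Proof.
move=> /andP[q0 q1] /andP[u0 u1] uq.
have x0 : 0 <= q * k%:R by rewrite mulr_ge0.
apply: (@le_trans _ _ (expR (- q) ^+ k)).
  by apply: lerXn2r; rewrite ?nnegrE ?expR_ge0 ?subr_ge0 // expR_ge1Dx.
rewrite -expRM_natl mulrN mulrC.
have -> : - (q * k%:R) = - (q * k%:R / 2) + - (q * k%:R / 2) by lra.
rewrite expRD ler_wpM2l ?expR_ge0 //; apply: le_trans (expRN_le_inv _) _; first by lra.
set y := q * k%:R in x0 uq *.
have y0 : 0 < 1 + y / 2 by lra.
by rewrite -(ler_pM2l y0) divff ?gt_eqF //; nra.
Qed.

(** For [n >= 2] the binomial coefficient is at least [n ^+ 2 / 4]. *)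
Lemma sum_deg_ge (V : finType) (G : sgraph V) : (1 < #|V|)%N ->
  edge_density G R / 4 * #|V|%:R ^+ 2 <= (\sum_x #|[set y | G x y]|)%:R.
Proof.
move=> n1; rewrite /edge_density.
apply: (@le_trans _ _ #|edges G|%:R); last by rewrite ler_nat card_edges_le_sum_deg.
have n2 : 2 <= #|V|%:R :> R by rewrite ler_nat.
have C2 : 'C(#|V|, 2)%:R = (#|V|%:R - 1) * #|V|%:R / 2 :> R.
  have := mul_bin_left #|V| 1; rewrite bin1 => /(congr1 (fun n => n%:R : R)).
  by rewrite !natrM natrB 1?ltnW // => <-; field.
rewrite C2; set n : R := #|V|%:R in n2 *; set e : R := #|edges G|%:R.
have e0 : 0 <= e by exact: ler0n.
have h : 0 < (n - 1) * n / 2 by apply: divr_gt0 => //; apply: mulr_gt0; lra.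
have hC : n ^+ 2 / 4 <= (n - 1) * n / 2 by nra.
move: ((n - 1) * n / 2) h hC => C C0 hC.
rewrite (_ : e / C / 4 * n ^+ 2 = e * (n ^+ 2 / 4) / C); last by field; rewrite gt_eqF.
by rewrite ler_pdivrMr // ler_wpM2l.
Qed.

Lemma sum_deg_le (V : finType) (G : sgraph V) :
  (\sum_x #|[set y | G x y]|)%:R <= #|V|%:R ^+ 2 :> R.
Proof.
rewrite -natrX ler_nat expnS expn1 -sum_nat_const.
by apply: leq_sum => x _; apply: max_card.
Qed.

(** Measured in the sixteenth root [s] of the order, the density threshold is [s ^- 2], and the size
    estimates compare integer powers. *)
Lemma powR_root16 (x : R) : 0 <= x -> (x `^ (1 / 16)) ^+ 16 = x.
Proof.
move=> x0; rewrite -powR_mulrn ?powR_ge0 // -powRrM.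
by rewrite mul1r mulVf ?powRr1.
Qed.

Lemma powR_root16_sqV (x : R) : 0 <= x -> x `^ (- (1 / 8)) = ((x `^ (1 / 16)) ^+ 2)^-1.
Proof.
move=> x0; rewrite powRN -powR_mulrn ?powR_ge0 // -powRrM.
by congr ((_ `^ _)^-1); field.
Qed.

Lemma powRN_half_sq (x : R) : 0 < x -> (x `^ (- (1 / 2))) ^+ 2 = x^-1.
Proof.
move=> x0; rewrite -powR_mulrn ?powR_ge0 // -powRrM.
rewrite (_ : - (1 / 2) * 2 = -1); last by field.
by rewrite powRN powRr1 // ltW.
Qed.

Lemma log2_bounds (x s : R) : 1 <= s -> x = s ^+ 16 -> 0 <= log2 x <= 32 * ln s.
Proof.
move=> s1 ->; have ln2 := ln2_ge_half.
have s0 : 0 < s by lra.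
have lns : 0 <= ln s by rewrite ln_ge0.
rewrite /log2 lnXn // -(mulr_natl (ln s)); apply/andP; split.
  by apply: divr_ge0; [rewrite mulr_ge0 | lra].
rewrite ler_pdivrMr; last by lra.
by nra.
Qed.

End RealEstimates.

(** * Choice of parameters for large [n] *)

Lemma expr_gap (R : realFieldType) (a s : R) (i j : nat) :
  a <= s -> 1 <= s -> (i < j)%N -> a * s ^+ i <= s ^+ j.
Proof.
move=> as1 s1 ij; apply: (@le_trans _ _ (s ^+ i.+1)).
  by rewrite exprS ler_wpM2r ?exprn_ge0 //; lra.
exact: ler_weXn2l.
Qed.

(* Here [s] is the sixteenth root of the number of vertices. *)
Lemma size_conditions (R : realType) (s n p : R) (k t N : nat) :
  200 <= s -> n = s ^+ 16 -> 1 <= p * s ^+ 2 ->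
  k%:R <= s ^+ 2 -> t%:R <= s ^+ 3 -> N%:R <= 2 * s ^+ 5 ->
  [/\ (6 * k * t)%:R ^+ 2 <= (p / 4) ^+ 2 * n / 8,
      (6 * k * t)%:R < p / 4 / 4 * ((p / 4) ^+ 2 * n / 8),
      (N * k)%:R <= p / 4 / 8 * ((p / 4) ^+ 2 * n / 8) &
      (N * k + t * k)%:R <= (s ^+ 2)^-1 / 32 * (p / 4 / 4 * n)].
Proof.
move=> s1 -> ps ks ts Ns.
have s0 : 0 < s by lra.
have s1' : 1 <= s by lra.
(* Two spare powers of [s] absorb a constant 40000, enough for all the constants below. *)
have sX2 i j : (i.+1 < j)%N -> 200 * (200 * s ^+ i) <= s ^+ j.
  move=> ij; apply: le_trans (expr_gap s1 s1' ij).
  by apply: ler_wpM2l; [exact: ler0n | exact: expr_gap s1 s1' (ltnSn i)].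
have p0 : 0 < p.
  by rewrite -(pmulr_lgt0 _ (exprn_gt0 2 s0)); apply: lt_le_trans ps; exact: ltr01.
have kt : k%:R * t%:R <= s ^+ 5.
  by rewrite (exprD s 2 3) ler_pM.
have Nk : N%:R * k%:R <= 2 * s ^+ 7.
  by rewrite (exprD s 5 2) mulrA ler_pM.
have tk : t%:R * k%:R <= s ^+ 5 by rewrite mulrC.
have p1n : s ^+ 14 <= p * s ^+ 16.
  rewrite (exprD s 2 14) mulrA -[leLHS]mul1r ler_wpM2r ?exprn_ge0 //; lra.
have p2n : s ^+ 12 <= p ^+ 2 * s ^+ 16.
  rewrite (exprD s 4 12) (exprM s 2 2) mulrA -exprMn -[leLHS]mul1r.
  by rewrite ler_wpM2r ?exprn_ge0 ?exprn_ege1 //; lra.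
have p3n : s ^+ 10 <= p ^+ 3 * s ^+ 16.
  rewrite (exprD s 6 10) (exprM s 2 3) mulrA -exprMn -[leLHS]mul1r.
  by rewrite ler_wpM2r ?exprn_ge0 ?exprn_ege1 //; lra.
have kt0 : 0 <= k%:R * t%:R :> R by rewrite mulr_ge0.
have s5 : 0 < s ^+ 5 by rewrite exprn_gt0.
rewrite natrD -!mulnA !natrM; split.
- have h : (k%:R * t%:R) ^+ 2 <= s ^+ 10.
    by rewrite (exprM s 5 2) lerXn2r ?nnegrE ?exprn_ge0 // ltW.
  rewrite (_ : (p / 4) ^+ 2 * s ^+ 16 / 8 = p ^+ 2 * s ^+ 16 / 128); last by field.
  rewrite exprMn; move: h (exprn_gt0 10 s0) p2n (sX2 10%N 12%N isT).
  by move: ((_ * _) ^+ 2) (s ^+ 10) (s ^+ 12) (p ^+ 2 * _) => a b d e; clear; lra.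
- rewrite (_ : _ * (_ / 8) = p ^+ 3 * s ^+ 16 / 16 / 128); last by field.
  move: kt s5 p3n (sX2 5%N 10%N isT).
  by move: (_ * t%:R) (s ^+ 5) (s ^+ 10) (p ^+ 3 * _) => a b d e; clear; lra.
- rewrite (_ : _ * (_ / 8) = p ^+ 3 * s ^+ 16 / 32 / 128); last by field.
  move: Nk (exprn_gt0 7 s0) p3n (sX2 7%N 10%N isT).
  by move: (_ * k%:R) (s ^+ 7) (s ^+ 10) (p ^+ 3 * _) => a b d e; clear; lra.
rewrite (_ : _ * (p / 4 / 4 * _) = p * s ^+ 16 / 16 / 32 / s ^+ 2); last first.
  by field; rewrite gt_eqF.
rewrite ler_pdivlMr ?exprn_gt0 //.
have : (N%:R * k%:R + t%:R * k%:R) * s ^+ 2 <= 2 * s ^+ 9 + s ^+ 7.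
  rewrite mulrDl; apply: lerD.
    by rewrite (exprD s 7 2) mulrA ler_wpM2r // exprn_ge0 // ltW.
  by rewrite (exprD s 5 2) ler_wpM2r // exprn_ge0 // ltW.
move: p1n (sX2 7%N 14%N isT) (sX2 9%N 14%N isT) (exprn_gt0 7 s0) (exprn_gt0 9 s0).
by move: (s ^+ 7) (s ^+ 9) (s ^+ 14) (p * _) (_ * s ^+ 2) => a b d e f; clear; lra.
Qed.

Theorem theorem5p3 (R : realType) :
  exists n0 : nat, forall (n : nat) (V : finType) (G : sgraph V)
    (p r : R) (t : nat),
    (n0 <= n)%N ->
    #|V| = n ->
    p = edge_density G R ->
    n%:R `^ (- (1 / 8)) <= p ->
    24 * p `^ (- (1 / 2)) <= r ->
    r <= 1 / 2 * Num.sqrt (p^-1 * log2 (n%:R : R)) ->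
    t%:R <= 1 / 32 * expR (p * r ^+ 2 / 256) * log2 (n%:R : R) ->
    exists A : 'I_t -> {set V},
      Kminor G A /\ forall i : 'I_t, #|A i|%:R <= 8 * r.
Proof.
exists (Num.truncn (200 ^+ 16 : R)).+1 => n V G p r t n0n cV pE.
set x : R := n%:R; pose s := x `^ (1 / 16).
have x0 : 0 <= x by exact: ler0n.
have xs : x = s ^+ 16 by rewrite powR_root16.
have s1 : 200 <= s.
  rewrite -(@ler_pXn2r _ 16) ?nnegrE ?powR_ge0 // powR_root16 //.
  by apply/ltW/(lt_le_trans (truncnS_gt _)); rewrite ler_nat.
have s0 : 0 < s by lra.
have x1 : 1 < x by rewrite xs exprn_egt1 //; lra.
have V1 : (1 < #|V|)%N by rewrite cV -(ltr_nat R).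
rewrite powR_root16_sqV // -/s => sp rlow rup tup.
have p0 : 0 < p by apply: lt_le_trans sp; rewrite invr_gt0 exprn_gt0.
have ps : 1 <= p * s ^+ 2 by rewrite -ler_pdivrMr ?exprn_gt0 // mul1r.
have degG : p / 4 * #|V|%:R ^+ 2 <= (\sum_x #|[set y | G x y]|)%:R.
  by rewrite pE; apply: sum_deg_ge.
(* This crude bound gives [1 / 2 <= a], hence [12 <= r] and later [6 <= k]. *)
have p4 : p <= 4.
  have := le_trans degG (sum_deg_le R G); rewrite -[leRHS]mul1r ler_pM2r.
    by lra.
  by rewrite exprn_gt0 // ltr0n ltnW.
have s1' : 1 <= s by lra.
have /andP[L0 Ls] := log2_bounds s1' xs.
set L := log2 x in rup tup L0 Ls.
have lns : ln s <= s by rewrite -[leRHS]expRK ler_ln ?posrE ?expR_gt0 //; have := expR_ge1Dx s; lra.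
have Ls2 : L <= s ^+ 2 by rewrite expr2; nra.
pose a := p `^ (- (1 / 2)).
have a0 : 0 <= a by exact: powR_ge0.
have pa : p * a ^+ 2 = 1 by rewrite powRN_half_sq // mulfV ?gt_eqF.
have ah : 1 / 2 <= a by nra.
have r12 : 12 <= r by rewrite -/a in rlow; lra.
have pr_low : 576 <= p * r ^+ 2.
  have : (24 * a) ^+ 2 <= r ^+ 2 by rewrite lerXn2r ?nnegrE //; lra.
  by rewrite -(ler_pM2l p0) exprMn mulrCA pa; lra.
have pr_up : p * r ^+ 2 <= L / 4.
  have : r ^+ 2 <= (1 / 2 * Num.sqrt (p^-1 * L)) ^+ 2 by rewrite lerXn2r ?nnegrE //; lra.
  rewrite exprMn sqr_sqrtr; last by apply: mulr_ge0; rewrite // invr_ge0 ltW.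
  rewrite -(ler_pM2l p0) => /le_trans; apply.
  by rewrite (_ : p * (_ * _) = L / 4) //; field; rewrite gt_eqF.
have rs : r <= s ^+ 2.
  have : r ^+ 2 <= (s ^+ 2) ^+ 2.
    rewrite -(ler_pM2l p0); apply: le_trans pr_up _.
    by rewrite [(s ^+ 2) ^+ 2]expr2 mulrA; nra.
  by rewrite ler_pXn2r ?nnegrE ?exprn_ge0 //; lra.
have exp_s y : y <= ln s -> expR y <= s.
  by move=> h; rewrite -(lnK (_ : s \is Num.pos)) ?posrE // ler_expR.
(* The exponent is at most [L / 1024], well below [ln s], and [L <= s ^+ 2]. *)
have ts : t%:R <= s ^+ 3.
  apply: le_trans tup _.
  have : expR (p * r ^+ 2 / 256) <= s by apply: exp_s; lra.
  have : 0 <= expR (p * r ^+ 2 / 256) by exact: expR_ge0.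
  move: (expR _) => E E0 Es.
  have : E * L <= s * s ^+ 2 by rewrite ler_pM.
  rewrite -exprS => h; have := exprn_gt0 3 s0; lra.
pose k := Num.truncn r.
have /andP[kr rk] : k%:R <= r < k.+1%:R by apply: truncn_itv; lra.
have kr2 : r / 2 <= k%:R by move: rk; rewrite -natr1; lra.
have k0 : (0 < k)%N by rewrite -(ltr0n R); lra.
(* About [s ^+ 5] sets suffice: a fraction [s ^- 2] survives, leaving [s ^+ 3], which is at least
   [t]. *)
pose N := (Num.truncn (s ^+ 5)).+1.
have Nlow : s ^+ 5 <= N%:R by apply/ltW/truncnS_gt.
have Nup : N%:R <= 2 * s ^+ 5.
  have : (Num.truncn (s ^+ 5))%:R <= s ^+ 5 by rewrite truncn_le exprn_ge0 // ltW.
  have : 1 <= s ^+ 5 by apply: exprn_ege1.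
  by rewrite /N -natr1; lra.
have [c1 c2 c3 c4] := size_conditions s1 xs ps (le_trans kr rs) ts Nup.
pose eta := expR (- (p / 4 / 8 * k%:R / 2)).
have pk0 : 0 <= p * k%:R by rewrite mulr_ge0 // ltW.
have /andP[sV0 sV1] : 0 < (s ^+ 2)^-1 <= 1.
  by rewrite invr_gt0 exprn_gt0 //= invf_le1 ?exprn_gt0 ?exprn_ege1.
have pk : 6 * (s ^+ 2)^-1 <= p * k%:R.
  apply: le_trans (ler_wpM2l (ltW p0) (_ : 6 <= k%:R)); last by lra.
  by rewrite mulrC ler_wpM2r.
have eta01 : 0 <= eta <= 1 by rewrite expR_ge0 /= -expR0 ler_expR; lra.
have qeta : (1 - p / 4 / 8) ^+ k <= eta * (1 - (s ^+ 2)^-1 / 32).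
  by apply: onesubX_le_expR; [apply/andP; split | apply/andP; split |]; lra.
pose eps := eta ^+ k.
(* [eps] is [expR (- (p * k ^ 2 / 64))], and [k >= r / 2] turns 64 into 256. *)
have eps_le : eps <= expR (- (p * r ^+ 2 / 256)).
  rewrite /eps -expRM_natr ler_expR.
  have : p * (r / 2) ^+ 2 <= p * k%:R ^+ 2.
    by apply: ler_wpM2l; [exact: ltW | apply: lerXn2r; rewrite ?nnegrE //; lra].
  by nra.
(* The constant 24 enters here: [24 ^ 2 = 576] makes [1 + p * r ^+ 2 / 256] exceed 2. *)
have eps01 : 0 <= eps <= 1 / 2.
  rewrite exprn_ge0 ?expR_ge0 //=; apply: le_trans eps_le _.
  apply: le_trans (expRN_le_inv _) _; first by lra.
  by rewrite mul1r lef_pV2 ?posrE; lra.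
(* The exponential in the bound on [t] cancels [eps]. As [L / 16 <= 2 * ln s], the surviving
   fraction [(1 - eps) ^+ t] is at least [s ^- 2]. *)
have epst : 2 * eps * t%:R <= L / 16.
  have : eps * t%:R <= expR (- (p * r ^+ 2 / 256)) *
      (1 / 32 * expR (p * r ^+ 2 / 256) * L).
    by apply: ler_pM => //; case/andP: eps01.
  rewrite (_ : _ * (_ * L) = L / 32); first by lra.
  by rewrite expRN; field; rewrite gt_eqF ?expR_gt0.
have tN : t%:R <= (1 - eps) ^+ t * N%:R.
  have h : (s ^+ 2)^-1 <= (1 - eps) ^+ t.
    apply: (@le_trans _ _ (expR (- (2 * eps)) ^+ t)); last first.
      apply: lerXn2r; rewrite ?nnegrE ?expR_ge0 ?expR_le_onesub //.
      by case/andP: eps01; lra.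
    rewrite -expRM_natr -{1}(lnK (_ : s \is Num.pos)) ?posrE //.
    by rewrite -expRM_natl -expRN ler_expR; lra.
  apply: le_trans ts _; apply: le_trans (ler_pM _ _ h Nlow).
  - by rewrite (exprD s 2 3) mulKf // expf_neq0 // gt_eqF.
  - exact: ltW.
  - by rewrite exprn_ge0 // ltW.
rewrite /x -cV in c1 c2 c3 c4.
have [||A [minA cA]] := @exists_Kminor R V G (p / 4) eta ((s ^+ 2)^-1 / 32) k t N k0
    _ eta01 _ degG c1 c2 c3 c4 qeta tN.
- by apply/andP; split; lra.
- by apply/andP; split; lra.
exists A; split=> // i; apply: (@le_trans _ _ (6 * k)%:R); first by rewrite ler_nat.
by rewrite natrM; lra.
Qed.
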